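(* Let $\boldsymbol{A}\in\mathcal{DM}_{\rm loc}(\Omega)$ and let $\lambda:\Omega\to[0,1]$ be a Borel function. The function $E\mapsto P_{\boldsymbol{A},\lambda}(E,\Omega)$, defined on Borel subsets of $\Omega$, is lower semicontinuous with respect to the $(\boldsymbol{A},\lambda)$-convergence; that is, if a sequence of Borel sets $(E_n)_n$ $(\boldsymbol{A},\lambda)$-converges to a Borel set $E$, then $$P_{\boldsymbol{A},\lambda}(E,\Omega)\le\liminf_{n\to+\infty}P_{\boldsymbol{A},\lambda}(E_n,\Omega).$$
   Context: $\Omega\subset\mathbb{R}^N$ is a nonempty open set; $\mathcal{M}_{\rm loc}(\Omega)$, $\mathcal{M}_{\rm loc}(\Omega;\mathbb{R}^N)$ are the spaces of locally finite real, respectively $\mathbb{R}^N$-valued, Radon measures on $\Omega$. $\mathcal{DM}_{\rm loc}(\Omega)$ is the set of $\boldsymbol{A}\in\mathcal{M}_{\rm loc}(\Omega;\mathbb{R}^N)$ with distributional divergence $\mathrm{div}\boldsymbol{A}\in\mathcal{M}_{\rm loc}(\Omega)$. For a Borel set $E$: $E^1$ is the set of points of Lebesgue density $1$ of $E$, $\partial^*E:=\mathbb{R}^N\setminus(E^1\cup(\mathbb{R}^N\setminus E)^1)$, and $\chi_E^\lambda:=\chi_{E^1}+\lambda\chi_{\partial^*E}$. The $(\boldsymbol{A},\lambda)$-perimeter of $E$ in $\Omega$ is $$P_{\boldsymbol{A},\lambda}(E,\Omega):=\sup\Big\{\int_\Omega\chi_E^\lambda\nabla\varphi\cdot d\boldsymbol{A}+\int_\Omega\chi_E^\lambda\varphi\,d\,\mathrm{div}\boldsymbol{A}:\varphi\in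 C^1_c(\Omega),\ \|\varphi\|_\infty\le1\Big\}\in[0,+\infty].$$ A sequence of Borel sets $(E_n)_n$ $(\boldsymbol{A},\lambda)$-converges to a Borel set $E$ if $\chi_{E_n}^\lambda\rightharpoonup\chi_E^\lambda$ weakly in $L^1_{\rm loc}(\Omega,|\boldsymbol{A}|)$ and weakly in $L^1_{\rm loc}(\Omega,|\mathrm{div}\boldsymbol{A}|)$ (weak convergence in $L^1_{\rm loc}(\Omega,\mu)$ means weak convergence in $L^1(\Omega',\mu)$ for every open $\Omega'\Subset\Omega$). *)

(* Defs.v *)
From HB Require Import structures.
From mathcomp Require Import all_boot all_order all_algebra.
From mathcomp Require Import all_classical all_reals all_analysis.

Set Implicit Arguments.
Unset Strict Implicit.
Unset Printing Implicit Defensive.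
Import Order.TTheory GRing.Theory Num.Theory.
Import numFieldNormedType.Exports.

Local Open Scope classical_set_scope.
Local Open Scope ring_scope.

(* R^N is 'rV[R]_N, measured by its Borel sigma-algebra. The library norm on
   'rV[R]_N is the sup norm; it is used only through the topology it induces. *)
HB.instance Definition _ (R : realType) (N : nat) :=
  Measurable.copy 'rV[R]_N (g_sigma_algebraType (@open 'rV[R]_N)).

Section Euclidean_space.
Context {R : realType} {N : nat}.
Notation T := 'rV[R]_N.

Definition enorm (v : T) : R := Num.sqrt (\sum_(i < N) v 0 i ^+ 2).

Definition eball (x : T) (r : R) : set T := [set y | enorm (y - x) < r].

Definition box (a b : T) : set T :=
  [set x | forall i, a 0 i < x 0 i /\ x 0 i <= b 0 i].

(* Lebesgue outer measure, which is Lebesgue measure on measurable sets. *)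
Definition leb (B : set T) : \bar R :=
  ereal_inf [set s | exists a b : nat -> T,
    [/\ forall k i, a k 0 i <= b k 0 i,
        B `<=` \bigcup_k box (a k) (b k) &
        s = (\sum_(0 <= k <oo) (\prod_(i < N) (b k 0 i - a k 0 i))%:E)%E]].

(* E^1 *)
Definition density1 (E : set T) : set T :=
  [set x | fine (leb (E `&` eball x r)) / fine (leb (eball x r)) @[r --> 0^'+]
           --> (1 : R)].

(* \partial^* E *)
Definition ess_boundary (E : set T) : set T :=
  ~` (density1 E `|` density1 (~` E)).

(* \chi_E^\lambda *)
Definition chi (lam : T -> R) (E : set T) (x : T) : R :=
  \1_(density1 E) x + lam x * \1_(ess_boundary E) x.

Definition partial (i : 'I_N) (phi : T -> R) (x : T) : R :=
  'D_(delta_mx 0 i) phi x.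

Fixpoint Ck (k : nat) (phi : T -> R) : Prop :=
  if k is k'.+1 then
    (forall x, differentiable phi x) /\ forall i, Ck k' (partial i phi)
  else continuous phi.

(* O' \Subset O *)
Definition rel_compact (O B : set T) : Prop :=
  compact (closure B) /\ closure B `<=` O.

(* C^k_c(O), each function being extended by 0 to R^N. *)
Definition Ckc (k : nat) (O : set T) : set (T -> R) :=
  [set phi | Ck k phi /\ rel_compact O [set x | phi x != 0]].

Definition Cinfc (O : set T) : set (T -> R) := [set phi | forall k, Ckc k O phi].

End Euclidean_space.

Section Radon_measures.
Context {R : realType} {N : nat}.
Notation T := 'rV[R]_N.

(* A locally finite real Radon measure on O is a set function on the Borel sets
   that are relatively compact in O, whose restriction to each compact subset of
   O is a finite signed measure. Its values on all other sets are irrelevant;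
   every notion below only looks at the relatively compact Borel sets. *)
Definition Mloc (O : set T) : set (set T -> R) :=
  [set mu | forall K, compact K -> K `<=` O ->
    exists nu : {charge set T -> \bar R},
      forall B, measurable B -> nu B = (mu (B `&` K))%:E].

Definition Mloc_vec (O : set T) : set (set T -> T) :=
  [set A | forall i, Mloc O (fun B => A B 0 i)].

(* |mu|(B), where nrm is the norm of the space V of values of mu. *)
Definition total_variation (V : Type) (nrm : V -> R) (O : set T)
    (mu : set T -> V) (B : set T) : \bar R :=
  ereal_sup [set s | exists C : nat -> set T,
    [/\ forall h, measurable (C h) /\ rel_compact O (C h),
        trivIset setT C,
        \bigcup_h C h = B `&` O &
        s = (\sum_(0 <= h <oo) (nrm (mu (C h)))%:E)%E]].

(* The Jordan decomposition mu = mu^+ - mu^- of a real Radon measure. Both parts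
   are positive, possibly infinite, Borel measures concentrated on O. *)
Definition pos_part (O : set T) (mu : set T -> R) (B : set T) : \bar R :=
  ereal_sup [set (mu C)%:E | C in
    [set C | [/\ measurable C, rel_compact O C & C `<=` B]]].

Definition neg_part (O : set T) (mu : set T -> R) : set T -> \bar R :=
  pos_part O (fun B => - mu B).

(* \int_O f d mu for a real Radon measure mu; it is used only for bounded Borel
   functions f that vanish outside a compact subset of O, so that both integrals
   on the right-hand side are finite. *)
Definition integral_Radon (O : set T) (mu : set T -> R) (f : T -> R) : R :=
  fine (\int[pos_part O mu]_(x in O) (f x)%:E)%E -
  fine (\int[neg_part O mu]_(x in O) (f x)%:E)%E.

(* \int_O f \nabla phi . dA *)
Definition integral_grad (O : set T) (A : set T -> T) (f phi : T -> R) : R :=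
  \sum_(i < N) integral_Radon O (fun B => A B 0 i) (fun x => f x * partial i phi x).

Definition is_div (O : set T) (A : set T -> T) (D : set T -> R) : Prop :=
  Mloc O D /\
  forall phi, Cinfc O phi ->
    integral_Radon O D phi = - integral_grad O A (cst 1) phi.

Definition DMloc (O : set T) : set (set T -> T) :=
  [set A | Mloc_vec O A /\ exists D, is_div O A D].

(* div A, chosen among the D with is_div O A D: these all agree on the Borel sets
   that are relatively compact in O. *)
Definition div (O : set T) (A : set T -> T) : set T -> R := get (is_div O A).

End Radon_measures.

Section perimeter.
Context {R : realType} {N : nat}.
Notation T := 'rV[R]_N.

Definition perimeter (O : set T) (A : set T -> T) (lam : T -> R) (E : set T)
    : \bar R :=
  ereal_sup [set (integral_grad O A (chi lam E) phi +
                  integral_Radon O (div O A) (fun x => chi lam E x * phi x))%:E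
            | phi in [set phi | Ckc 1 O phi /\ forall x, `|phi x| <= 1]].

(* Bounded linear functionals on L^1(D, mu). By boundedness, L does not separate
   functions that are equal mu-almost everywhere on D. *)
Definition L1_dual (mu : set T -> \bar R) (D : set T) : set ((T -> R) -> R) :=
  [set L |
    (forall (a : R) f g, mu.-integrable D (EFin \o f) ->
       mu.-integrable D (EFin \o g) ->
       L (fun x => a * f x + g x) = a * L f + L g) /\
    (exists M : R, forall f, mu.-integrable D (EFin \o f) ->
       ((`|L f|)%:E <= M%:E * \int[mu]_(x in D) (`|f x|)%:E)%E)].

Definition weak_L1_cvg (mu : set T -> \bar R) (D : set T)
    (f_ : nat -> T -> R) (f : T -> R) : Prop :=
  [/\ forall n, mu.-integrable D (EFin \o f_ n),
      mu.-integrable D (EFin \o f) &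
      forall L, L1_dual mu D L -> L (f_ n) @[n --> \oo] --> L f].

Definition weak_L1loc_cvg (O : set T) (mu : set T -> \bar R)
    (f_ : nat -> T -> R) (f : T -> R) : Prop :=
  forall O', open O' -> rel_compact O O' -> weak_L1_cvg mu O' f_ f.

Definition Alambda_cvg (O : set T) (A : set T -> T) (lam : T -> R)
    (E_ : nat -> set T) (E : set T) : Prop :=
  weak_L1loc_cvg O (total_variation enorm O A) (fun n => chi lam (E_ n)) (chi lam E)
  /\ weak_L1loc_cvg O (total_variation Num.norm O (div O A))
       (fun n => chi lam (E_ n)) (chi lam E).

End perimeter.

(* Main.v *)
(* For a fixed test function [phi], the quantity whose supremum defines the
   perimeter is a bounded linear functional of [chi_E^lambda] on [L^1(D, |A|)]
   and [L^1(D, |div A|)], where [D] is a relatively compact neighbourhood of the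
   support of [phi]: the Jordan parts of each [A_i] and of [div A] are dominated
   by [|A|] and [|div A|], and [phi] and its partial derivatives are bounded. It
   is thus continuous along (A, lambda)-convergent sequences, and a supremum of
   sequentially continuous functionals is sequentially lower semicontinuous. *)
Require Import Defs.
From mathcomp Require Import all_boot all_order all_algebra.
From mathcomp Require Import finmap measurable_realfun.
From mathcomp Require Import all_classical all_reals all_analysis.

Set Implicit Arguments.
Unset Strict Implicit.
Unset Printing Implicit Defensive.
Import Order.TTheory GRing.Theory Num.Theory.
Import numFieldNormedType.Exports.
Local Open Scope classical_set_scope.
Local Open Scope ring_scope.

(** * Comparison of integrals against arbitrary set functions *)

Section integral_set_function.
Import HBNNSimple.
Context {d : measure_display} {T : measurableType d} {R : realType}.
Local Open Scope ereal_scope.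
Implicit Types (m : set T -> \bar R) (D O : set T) (f : T -> \bar R).

(* [total_variation] and [pos_part] are not known to be measures, so their
   integrals are compared with those of genuine measures through the definition
   of the integral, which makes sense for any set function. *)
Lemma le_sintegral_set_function m1 m2 D (h : {nnsfun T >-> R}) :
  m1 set0 = 0 -> m2 set0 = 0 ->
  (forall B, measurable B -> B `<=` D -> m1 B <= m2 B) ->
  (forall x, ~ D x -> h x = 0%R) -> sintegral m1 h <= sintegral m2 h.
Proof.
move=> m10 m20 m12 hD.
have E m : m set0 = 0 ->
    sintegral m h = \sum_(x \in range h) x%:E * m (h @^-1` [set x]).
  move=> m0; rewrite /sintegral (fsbig_widen (range h) setT)//= => x [_ Nhx] /=.
  by rewrite preimage10// m0 mule0.
rewrite !E//; apply: lee_fsum; first exact: fimfunP.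
(* The level set of 0 may leave [D], but it has weight 0; all other level sets lie in [D]. *)
move=> _ [t _ <-]; have [->|ht0] := eqVneq (h t) 0%R; first by rewrite !mul0e.
apply: lee_wpmul2l; first by rewrite lee_fin.
apply: m12; first exact: measurable_sfunP.
by move=> x /= hxt; apply: contrapT => /hD hx0; rewrite -hxt hx0 eqxx in ht0.
Qed.

(** A nonnegative simple function below [f] must vanish wherever [f <= 0], hence outside [D]. *)
Let le_nnintegral_set_function m1 m2 D f :
  m1 set0 = 0 -> m2 set0 = 0 ->
  (forall B, measurable B -> B `<=` D -> m1 B <= m2 B) ->
  (forall x, ~ D x -> f x <= 0) ->
  ereal_sup [set sintegral m1 h |
    h in [set h : {nnsfun T >-> R} | forall x, (h x)%:E <= f x]] <=
  ereal_sup [set sintegral m2 h |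
    h in [set h : {nnsfun T >-> R} | forall x, (h x)%:E <= f x]].
Proof.
move=> m10 m20 m12 fD; apply: ge_ereal_sup => _ [h hf <-].
apply: (@le_trans _ _ (sintegral m2 h)); last first.
  by apply: ereal_sup_ubound; exists h.
apply: (@le_sintegral_set_function _ _ D) => // x /fD fx0.
by apply/eqP; rewrite eq_le -2!lee_fin (le_trans (hf x) fx0)/= lee_fin.
Qed.

Lemma le_integral_set_function m1 m2 D f :
  m1 set0 = 0 -> m2 set0 = 0 ->
  (forall B, measurable B -> B `<=` D -> m1 B <= m2 B) ->
  (forall x, D x -> 0 <= f x) ->
  \int[m1]_(x in D) f x <= \int[m2]_(x in D) f x.
Proof.
move=> m10 m20 m12 f0; rewrite /integral; apply: leeB.
  apply: (@le_nnintegral_set_function _ _ D) => // x Dx.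
  by rewrite funeposE /patch memNset// maxxx.
(* The negative part is compared in the opposite direction; it vanishes everywhere, so [set0] can
   serve as the domain. *)
apply: (@le_nnintegral_set_function _ _ set0) => //=.
  by move=> B _; rewrite subset0 => ->; rewrite m10 m20.
move=> x _; rewrite funenegE ge_max lexx andbT leeNl oppe0.
by rewrite /patch; case: ifPn => // /[!inE]; exact: f0.
Qed.

Lemma eq_integral_set_function m1 m2 D O f :
  m1 set0 = 0 -> m2 set0 = 0 ->
  (forall B, measurable B -> B `<=` D -> m1 B = m2 B) ->
  (forall x, ~ D x -> f x = 0) ->
  \int[m1]_(x in O) f x = \int[m2]_(x in O) f x.
Proof.
move=> m10 m20 m12 fD.
have fDO x : ~ D x -> (f \_ O) x = 0.
  by move=> Dx; rewrite /patch; case: ifPn => // _; exact: fD.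
by rewrite /integral; congr (_ - _); apply/eqP; rewrite eq_le;
  apply/andP; split; apply: (@le_nnintegral_set_function _ _ D) => //;
  do ?[by move=> B mB BD; rewrite m12];
  move=> x Dx; rewrite ?(funeposE, funenegE) fDO// ?oppe0 maxxx.
Qed.

End integral_set_function.

(** * Borel sets, compact exhaustions and relatively compact neighbourhoods *)

Section topology_rV.
Context {R : realType} {N : nat}.
Notation T := 'rV[R]_N.
Implicit Types (O B C S : set T).

Lemma open_measurable_rV O : open O -> measurable O.
Proof. by move=> oO; exact: sub_sigma_algebra. Qed.

Lemma closed_measurable_rV C : closed C -> measurable C.
Proof.
by move=> cC; rewrite -[C]setCK; apply: measurableC;
  apply: open_measurable_rV; exact: closed_openC.
Qed.

Lemma continuous_measurable_rV (f : T -> R) : continuous f ->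
  measurable_fun setT f.
Proof.
move=> /continuousP cf; apply: (measurability _ (RGenOpens.measurableE R)).
move=> _ [_ [a [b ->] <-]]; rewrite setTI; apply: open_measurable_rV.
exact/cf/interval_open.
Qed.

Lemma rel_compact_sub O B C : rel_compact O C -> B `<=` C -> rel_compact O B.
Proof.
move=> [cC CO] BC; split.
  apply: (subclosed_compact _ cC); first exact: closed_closure.
  exact: closure_subset.
exact: subset_trans (closure_subset BC) CO.
Qed.

Lemma compact_rel_compact O C : compact C -> C `<=` O -> rel_compact O C.
Proof.
move=> cC CO; have clC : closed C.
  by apply: compact_closed => //; exact: norm_hausdorff.
have CE : closure C = C by apply/esym/closure_id.
by split; rewrite CE.
Qed.

(** The standard exhaustion: points of norm at most [n] whose distance to the complement of [O] is
    at least [1/(n+1)]. *)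
Let exh O (n : nat) : set T :=
  [set x | `|x| <= n%:R /\ ball x n.+1%:R^-1 `<=` O].

Let exh_sub O n : exh O n `<=` O.
Proof.
by move=> x [_]; apply; apply: ballxx.
Qed.

Let exh_closed O n : closed (exh O n).
Proof.
have -> : exh O n = (fun x : T => `|x|) @^-1` [set r | r <= n%:R] `&`
    [set x | ball x n.+1%:R^-1 `<=` O] by [].
apply: closedI.
  by apply: closed_comp; [move=> x _; exact: norm_continuous|exact: closed_le].
(* A point [z] of the set closer to [x] than the slack [1/(n+1) - |x - y|] still has [y] in its
   ball. *)
move=> x clx y /=; rewrite -ball_normE /= => xy.
have e0 : 0 < n.+1%:R^-1 - `|x - y| by rewrite subr_gt0.
have [z [zO xz]] := clx _ (nbhsx_ballx x _ e0).
apply: zO; rewrite -ball_normE /=; move: xz; rewrite -ball_normE /= => xz.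
rewrite -(subrKA x) (le_lt_trans (ler_normD _ _))// [ `|z - x|]distrC.
by rewrite -ltrBrDr.
Qed.

Let exh_compact O n : compact (exh O n).
Proof.
apply: bounded_closed_compact; last exact: exh_closed.
exists n%:R; split; first exact: num_real.
by move=> M nM x [xn _]; exact: le_trans xn (ltW nM).
Qed.

Let exh_nd O : {homo exh O : n k / (n <= k)%N >-> n `<=` k}.
Proof.
move=> n k nk x [xn xO]; split; first by rewrite (le_trans xn)// ler_nat.
apply: subset_trans xO; apply: le_ball.
by rewrite lef_pV2 ?posrE// ler_nat.
Qed.

Let exh_interior O x : open O -> O x -> exists n, (exh O n)° x.
Proof.
move=> oO Ox; have /nbhs_ballP[e /= e0 xeO] := open_nbhs_nbhs (conj oO Ox).
have e20 : 0 < e / 2 by rewrite divr_gt0.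
(* [n] bounds the norm near [x]; [k] makes the radius at most [e / 2], so that balls about points of
   [ball x (e / 2)] stay in [ball x e]. *)
pose n := (Num.truncn (`|x| + e)).+1 ; pose k := (Num.truncn (e / 2)^-1).+1.
exists (maxn n k); apply/nbhs_ballP; exists (e / 2) => //= y.
rewrite -ball_normE /= => xy; split.
  apply: (@le_trans _ _ (`|x| + e)).
    rewrite -[y](subrK x) addrC (le_trans (ler_normD _ _))// lerD2l distrC.
    by rewrite (le_trans (ltW xy))// ler_pdivrMr// ler_peMr ?ler1n// ltW.
  apply: (@le_trans _ _ n%:R); last by rewrite ler_nat leq_maxl.
  exact: ltW (truncnS_gt _).
move=> z; rewrite -ball_normE /= => yz; apply: xeO; rewrite -ball_normE /=.
rewrite -(subrKA y) (le_lt_trans (ler_normD _ _))// [ltRHS](splitr e).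
apply: ltrD => //; apply: (lt_le_trans yz).
rewrite invf_ple ?posrE// (@le_trans _ _ k%:R)//.
  exact: ltW (truncnS_gt _).
by rewrite ler_nat leqW// leq_maxr.
Qed.

Lemma compact_exhaustion O : open O ->
  exists K : nat -> set T, (forall n, compact (K n)) /\ \bigcup_n K n = O.
Proof.
move=> oO; exists (exh O); split; first by move=> n; exact: exh_compact.
apply/seteqP; split => [x [n _]|x Ox]; first exact: exh_sub.
by have [n /interior_subset] := exh_interior oO Ox; exists n.
Qed.

Lemma rel_compact_nbhs O S : open O -> rel_compact O S ->
  exists O', [/\ open O', closure S `<=` O' & rel_compact O O'].
Proof.
move=> oO [cS SO]; have := cS; rewrite compact_cover.
move=> /(_ _ setT (fun n => (exh O n)°)) [].
- by move=> n _; exact: open_interior.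
- by move=> x /SO /(exh_interior oO)[n]; exists n.
(* The exhaustion is increasing, so the largest index of the finite subcover suffices. *)
move=> F _ SF; pose n := (\max_(i <- F) i)%N.
exists (exh O n)°; split.
- exact: open_interior.
- move=> x /SF[k /= kF]; apply: interiorS; apply: exh_nd.
  exact: (@leq_bigmax_seq _ _ xpredT (fun i => i)).
- apply: (@rel_compact_sub _ _ (exh O n)); last exact: interior_subset.
  by apply: compact_rel_compact; [exact: exh_compact|exact: exh_sub].
Qed.

End topology_rV.

(** * Jordan parts and total variation of Radon measures *)

Section radon.
Context {R : realType} {N : nat}.
Notation T := 'rV[R]_N.
Implicit Types (O B C : set T) (mu : set T -> R).
Local Open Scope ereal_scope.

Lemma Mloc_set0 O mu : Mloc O mu -> mu set0 = 0%R.
Proof.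
move=> /(_ set0 compact0 (@sub0set _ _))[nu] /(_ _ measurable0).
by rewrite charge0 set0I => -[].
Qed.

Lemma MlocN O mu : Mloc O mu -> Mloc O (fun B => - mu B)%R.
Proof.
move=> muO K cK KO; have [nu nuK] := muO K cK KO.
exists (copp nu) => B mB.
by rewrite -[LHS]/(- nu B) nuK.
Qed.

Lemma pos_part_set0 O mu : mu set0 = 0%R -> pos_part O mu set0 = 0.
Proof.
move=> mu0; rewrite /pos_part -[RHS]ereal_sup1; congr ereal_sup.
apply/seteqP; split => [_ [C [_ _ C0] <-]|_ ->].
  by move: C0; rewrite subset0 => ->; rewrite mu0.
exists set0; last by rewrite mu0.
by split => //; apply: compact_rel_compact; [exact: compact0|].
Qed.

(** Inside [K], [mu] is a charge with a Hahn decomposition [(P, Q)]. Its positive variation bounds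
    [mu C] for every [C] in [B], and [B]&[P] attains the bound. *)
Lemma pos_part_measure O mu K : Mloc O mu -> compact K -> K `<=` O ->
  exists m : {measure set T -> \bar R},
    forall B, measurable B -> B `<=` K -> pos_part O mu B = m B.
Proof.
move=> muO cK KO; have [nu nuK] := muO K cK KO.
have [P [Q PQ]] := Hahn_decomposition nu.
have [[mP _] _ _ _] := PQ.
exists (jordan_pos PQ) => B mB BK.
have muE C : measurable C -> C `<=` K -> (mu C)%:E = nu C.
  by move=> mC CK; rewrite nuK// (setIidl CK).
apply/eqP; rewrite eq_le; apply/andP; split.
  apply: ge_ereal_sup => _ [C [mC _ CB] <-].
  rewrite muE//; last exact: subset_trans BK.
  apply: (@le_trans _ _ (jordan_pos PQ C)); last first.
    by apply: le_measure => //; rewrite inE.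
  rewrite (jordan_decomp PQ mC).
  rewrite -[leLHS]/(jordan_pos PQ C + (-1)%:E * jordan_neg PQ C) mulN1e.
  by apply: geeDl; rewrite oppe_le0 measure_ge0.
apply: ereal_sup_ubound; exists (B `&` P).
  split => //; first exact: measurableI.
  apply: (@rel_compact_sub _ _ _ _ K); first exact: compact_rel_compact.
  by move=> x [/BK].
rewrite -[RHS]/(crestr0 nu mP B) /crestr0 mem_set// /crestr muE//.
  exact: measurableI.
by move=> x [/BK].
Qed.

Section variation.
Variables (V : Type) (nrm : V -> R) (O : set T) (mu : set T -> V).
Hypotheses (oO : open O) (nrm0 : forall v, (0 <= nrm v)%R).

Lemma le_total_variation B C : measurable B -> measurable C ->
  rel_compact O C -> C `<=` B -> (nrm (mu C))%:E <= Defs.total_variation nrm O mu B.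
Proof.
move=> mB mC OC CB; have [K [cK KO]] := compact_exhaustion oO.
pose F n := if n is k.+1 then K k `&` B else C.
have mF n : measurable (F n).
  case: n => [|n] //=; apply: measurableI => //; apply: closed_measurable_rV.
  by apply: compact_closed => //; exact: norm_hausdorff.
have OF n : rel_compact O (F n).
  case: n => [|n] //=; apply: (@rel_compact_sub _ _ _ _ (K n)).
    by apply: compact_rel_compact => //; rewrite -KO; exact: bigcup_sup.
  exact: subIsetl.
(* [C] is the first piece of a partition of [B `&` O], which a compact exhaustion
   of [O] completes. *)
apply: (@le_trans _ _ (\sum_(0 <= h <oo) (nrm (mu (seqDU F h)))%:E)).
  apply: (le_trans _ (nneseries_lim_ge 1 _)) => //; last first.
    by move=> n _ _; rewrite lee_fin.
  by rewrite big_nat1 /seqDU big_ord0 setD0.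
apply: ereal_sup_ubound; exists (seqDU F); split => //.
- move=> h; split.
    by apply: measurableD => //; apply: bigsetU_measurable.
  by apply: rel_compact_sub (OF h) _; exact: subDsetl.
- rewrite -seqDU_bigcup_eq; apply/seteqP; split => [x [[|n] _ /=]|x [Bx]].
  + by move=> Cx; split; [exact: CB|exact: OC.2 (subset_closure Cx)].
  + by move=> [Kx Bx]; split => //; rewrite -KO; exists n.
  + by rewrite -{1}KO => -[n _ Kx]; exists n.+1.
Qed.

Lemma total_variation_set0 : nrm (mu set0) = 0%R ->
  Defs.total_variation nrm O mu set0 = 0.
Proof.
move=> mu0; apply/eqP; rewrite eq_le; apply/andP; split.
  apply: ge_ereal_sup => _ [C [_ _ C0 ->]]; rewrite eseries0// => h _ _.
  have -> : C h = set0; last by rewrite mu0.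
  by rewrite -subset0 -(set0I O) -C0; exact: bigcup_sup.
rewrite -[leLHS]/(0%R%:E) -mu0; apply: le_total_variation => //.
by apply: compact_rel_compact; [exact: compact0|exact: sub0set].
Qed.

(** Meant for [nu] a coordinate of a vector measure, a scalar measure, or the opposite of either;
    the opposites handle negative parts. *)
Lemma pos_part_le_total_variation nu B :
  (forall C, nu C <= nrm (mu C))%R -> measurable B ->
  pos_part O nu B <= Defs.total_variation nrm O mu B.
Proof.
move=> numu mB; apply: ge_ereal_sup => _ [C [mC OC CB] <-].
by apply: le_trans (le_total_variation mB mC OC CB); rewrite lee_fin.
Qed.

End variation.
End radon.

(** * Weighted integrals against a measure dominated by a set function *)

Section dominated_integral.
Context {d : measure_display} {T : measurableType d} {R : realType}.
Variables (m : {measure set T -> \bar R}) (tv : set T -> \bar R) (D : set T).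
Variables (psi : T -> R) (M : R).
Hypotheses (mD : measurable D) (tv0 : tv set0 = 0%E).
Hypothesis mtv : forall B, measurable B -> B `<=` D -> (m B <= tv B)%E.
Hypotheses (mpsi : measurable_fun D psi) (M0 : 0 <= M).
Hypothesis psiM : forall x, D x -> `|psi x| <= M.
Variable f : T -> R.
Hypothesis tvf : tv.-integrable D (EFin \o f).

Let mf : measurable_fun D f.
Proof. by have /integrableP[/measurable_EFinP] := tvf. Qed.

Let le_mtv : (\int[m]_(x in D) `|f x|%:E <= \int[tv]_(x in D) `|f x|%:E)%E.
Proof.
by apply: le_integral_set_function => // x _; rewrite lee_fin.
Qed.

Let mfi : m.-integrable D (EFin \o f).
Proof.
apply/integrableP; split; first exact/measurable_EFinP.
by apply: le_lt_trans le_mtv _; have /integrableP[] := tvf.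
Qed.

Lemma integrable_mul_dominated : m.-integrable D (EFin \o (f \* psi)).
Proof.
apply: (@le_integrable _ _ _ _ _ _ _ (fun x => (M%:E * (f x)%:E)%E)) => //.
- by apply/measurable_EFinP; exact: measurable_funM.
- move=> x Dx; rewrite -EFinM /= lee_fin !normrM mulrC ler_wpM2r//.
  by rewrite (ger0_norm M0) psiM.
- exact: integrableZl.
Qed.

Lemma le_normr_Rintegral_dominated :
  (`|\int[m]_(x in D) (f x * psi x)|%:E <=
   M%:E * \int[tv]_(x in D) `|f x|%:E)%E.
Proof.
have intfp := integrable_mul_dominated.
apply: (@le_trans _ _ (\int[m]_(x in D) `|f x * psi x|%:E)%E).
  rewrite /Rintegral -abse_EFin fineK; last exact: integrable_fin_num.
  by apply: le_abse_integral => //; have /integrableP[] := intfp.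
(* [M] is factored out under the measure [m], where homogeneity holds; only then is [m] replaced by
   [tv]. *)
apply: (@le_trans _ _ (M%:E * \int[m]_(x in D) `|f x|%:E)%E); last first.
  by apply: lee_wpmul2l le_mtv; rewrite lee_fin.
have mnf : measurable_fun D (fun x => `|f x|%:E).
  by apply/measurable_EFinP; exact: measurableT_comp.
rewrite -ge0_integralZl_EFin//; apply: ge0_le_integral => //.
- apply/measurable_EFinP; apply: measurableT_comp => //.
  exact: measurable_funM.
- by apply: measurable_funeM.
- by move=> x Dx; rewrite -EFinM lee_fin normrM mulrC ler_wpM2r// psiM.
Qed.

End dominated_integral.

(** * Continuity of the functionals defined by test functions, and lower semicontinuity *)

Section lower_semicontinuity.
Context {R : realType} {N : nat}.
Notation T := 'rV[R]_N.
Implicit Types (O D : set T) (psi phi : T -> R).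

Lemma continuous_bounded_support O D psi : rel_compact O D -> continuous psi ->
  (forall x, ~ D x -> psi x = 0) ->
  exists2 M, 0 <= M & forall x, `|psi x| <= M.
Proof.
move=> [cD _] cpsi psiD.
have /compact_bounded[M [Mreal HM]] : compact (psi @` closure D).
  by apply: continuous_compact => //; exact: continuous_subspaceT.
(* Only numbers strictly above [M] are known to be bounds. *)
exists (`|M| + 1) => [|x]; first exact: addr_ge0.
have [Dx|Dx] := pselect (D x); last by rewrite psiD// normr0 addr_ge0.
apply: HM; last by exists x => //; exact: subset_closure.
by rewrite (le_lt_trans (ler_norm M))// ltrDl.
Qed.

Lemma integral_Radon_L1_dual O D (mu : set T -> R) (tv : set T -> \bar R) psi :
  Mloc O mu -> open D -> rel_compact O D -> tv set0 = 0%E ->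
  (forall B, measurable B -> (pos_part O mu B <= tv B)%E) ->
  (forall B, measurable B -> (neg_part O mu B <= tv B)%E) ->
  continuous psi -> (forall x, ~ D x -> psi x = 0) ->
  L1_dual tv D (fun f => integral_Radon O mu (fun x => f x * psi x)).
Proof.
move=> muO oD OD tv0 ptv ntv cpsi psiD.
have [M M0 psiM] := continuous_bounded_support OD cpsi psiD.
have [cD DO] := OD.
have DcD : D `<=` closure D by exact: subset_closure.
have mpsi : measurable_fun D psi.
  by apply: measurable_funTS; exact: continuous_measurable_rV.
have mD := open_measurable_rV oD.
(* As [psi] vanishes off [D], the integral only sees subsets of [closure D], where the Jordan part
   is a genuine measure. *)
have intE nu (m : {measure set T -> \bar R}) (f : T -> R) : Mloc O nu ->
    (forall B, measurable B -> B `<=` closure D -> pos_part O nu B = m B) ->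
    fine (\int[pos_part O nu]_(x in O) (f x * psi x)%:E)%E =
    \int[m]_(x in D) (f x * psi x).
  move=> nuO num; have nu0 := pos_part_set0 O (Mloc_set0 nuO).
  rewrite (@eq_integral_set_function _ _ _ _ m (closure D))//; last first.
    by move=> x Dx; rewrite psiD ?mulr0//; exact: contra_not (DcD x) Dx.
  rewrite /Rintegral (integral_mkcond O) (integral_mkcond D).
  congr fine; apply: eq_integral => x _; rewrite /patch.
  have [Dx|Dx] := pselect (D x).
    by rewrite !mem_set//; exact: DO (DcD _ Dx).
  by rewrite (memNset Dx) psiD// mulr0 if_same.
have [mp mpE] := pos_part_measure muO cD DO.
have [mn mnE] := pos_part_measure (MlocN muO) cD DO.
have mptv B : measurable B -> B `<=` D -> (mp B <= tv B)%E.
  by move=> mB BD; rewrite -mpE ?ptv//; exact: subset_trans DcD.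
have mntv B : measurable B -> B `<=` D -> (mn B <= tv B)%E.
  by move=> mB BD; rewrite -mnE ?ntv//; exact: subset_trans DcD.
have psiMD x : D x -> `|psi x| <= M by [].
have -> : (fun f => integral_Radon O mu (fun x => f x * psi x)) =
    (fun f => \int[mp]_(x in D) (f x * psi x) -
              \int[mn]_(x in D) (f x * psi x)).
  (* [neg_part] is by definition the [pos_part] of [- mu], so [intE] covers both terms. *)
  apply/funext => f; rewrite /integral_Radon (intE _ mp)// (intE _ mn)//.
  exact: MlocN.
split => [a f g tf tg|].
  have lin (m : {measure set T -> \bar R}) :
      (forall B, measurable B -> B `<=` D -> (m B <= tv B)%E) ->
      \int[m]_(x in D) ((a * f x + g x) * psi x) =
      a * (\int[m]_(x in D) (f x * psi x)) + \int[m]_(x in D) (g x * psi x).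
    move=> mtv.
    have mf := integrable_mul_dominated mD tv0 mtv mpsi M0 psiMD tf.
    have mg := integrable_mul_dominated mD tv0 mtv mpsi M0 psiMD tg.
    under eq_Rintegral do rewrite mulrDl -mulrA.
    rewrite RintegralD ?RintegralZl//.
    by under [X in _.-integrable _ X]eq_fun do rewrite /= EFinM; exact: integrableZl.
  by rewrite !lin// mulrBr opprD addrACA.
(* One [M] for each Jordan part. *)
exists (M + M) => f tf.
have bnd (m : {measure set T -> \bar R}) mtv :=
  @le_normr_Rintegral_dominated _ _ _ m _ _ _ _ mD tv0 mtv mpsi M0 psiMD _ tf.
rewrite EFinD ge0_muleDl ?lee_fin//.
apply: le_trans (leeD (bnd mp mptv) (bnd mn mntv)).
by rewrite -EFinD lee_fin ler_normB.
Qed.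

(** Off its closed support, [phi] coincides with 0 in a whole neighbourhood of [x]. *)
Lemma partial_out_support i phi x : ~ closure [set x | phi x != 0] x ->
  partial i phi x = 0.
Proof.
move=> nx; rewrite /partial (@near_eq_derive _ _ _ _ (cst 0)) ?derive_cst//.
have : nbhs x (~` closure [set x | phi x != 0]).
  by apply: open_nbhs_nbhs; split => //; exact/closed_openC/closed_closure.
apply: filterS => y ny /=; apply: contrapT => /eqP phiy.
exact/ny/subset_closure.
Qed.

Lemma coord_le_enorm (v : T) i : `|v 0 i| <= enorm v.
Proof.
rewrite -sqrtr_sqr /enorm ler_wsqrtr// (bigD1 i)//= lerDl.
by apply: sumr_ge0 => j _; exact: sqr_ge0.
Qed.

(** Keeping [nu] apart from [mu] covers both terms of the perimeter: a coordinate of [A] against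
    [|A|], and [div A] against its own variation. *)
Lemma cvg_integral_Radon O D V (nrm : V -> R) (mu : set T -> V)
    (nu : set T -> R) (psi : T -> R) (f_ : nat -> T -> R) (f : T -> R) :
  open O -> Mloc O nu -> open D -> rel_compact O D ->
  (forall v, 0 <= nrm v) -> nrm (mu set0) = 0 ->
  (forall C, `|nu C| <= nrm (mu C)) ->
  continuous psi -> (forall x, ~ D x -> psi x = 0) ->
  weak_L1loc_cvg O (Defs.total_variation nrm O mu) f_ f ->
  integral_Radon O nu (fun x => f_ n x * psi x) @[n --> \oo] -->
  integral_Radon O nu (fun x => f x * psi x).
Proof.
move=> oO nuO oD OD nrm0 mu0 numu cpsi psiD /(_ D oD OD)[_ _ ].
move=> /(_ (fun g => integral_Radon O nu (fun x => g x * psi x))); apply.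
apply: integral_Radon_L1_dual => //.
- exact: total_variation_set0.
- move=> B mB; apply: pos_part_le_total_variation => // C.
  exact: le_trans (ler_norm _) (numu C).
- move=> B mB; apply: pos_part_le_total_variation => // C.
  by apply: le_trans (numu C); rewrite -normrN ler_norm.
Qed.

End lower_semicontinuity.

Lemma le_limn_einf (R : realType) (u v : nat -> \bar R) :
  (forall n, u n <= v n)%E -> (limn_einf u <= limn_einf v)%E.
Proof.
move=> uv; rewrite !limn_einf_lim; apply: lee_lim.
- exact: is_cvg_einfs.
- exact: is_cvg_einfs.
apply: nearW => n; apply: le_ereal_inf_tmp => _ [k nk <-].
by apply: le_trans (uv k); apply: ereal_inf_lbound; exists k.
Qed.

Theorem proposition7p13 (R : realType) (N : nat) (N_gt0 : (0 < N)%N)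
    (Omega : set 'rV[R]_N) (Omega_open : open Omega) (Omega_neq0 : Omega !=set0)
    (A : set 'rV[R]_N -> 'rV[R]_N) (A_DMloc : DMloc Omega A)
    (lambda : 'rV[R]_N -> R) (lambda_Borel : measurable_fun Omega lambda)
    (lambda01 : forall x, Omega x -> 0 <= lambda x <= 1)
    (E_ : nat -> set 'rV[R]_N) (E : set 'rV[R]_N)
    (E_Borel_ : forall n, measurable (E_ n)) (E_Borel : measurable E)
    (E_cvg : Alambda_cvg Omega A lambda E_ E) :
  (perimeter Omega A lambda E <=
     limn_einf (fun n => perimeter Omega A lambda (E_ n)))%E.
Proof.
have [E_cvgA E_cvgdivA] := E_cvg; have [AO exD] := A_DMloc.
(* Some divergence exists, so the one chosen by [get] is a genuine one. *)
have DivO : Mloc Omega (Defs.div Omega A) by have [] := getPex exD.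
have A0 : enorm (A set0) = 0.
  rewrite /enorm big1 ?sqrtr0// => i _.
  by rewrite (Mloc_set0 (AO i)) expr0n.
apply: ge_ereal_sup => _ [phi [phiC phi1] <-].
have [[dphi cdphi] Sphi] := phiC.
have [D [oD SD OmegaD]] := rel_compact_nbhs Omega_open Sphi.
pose J F := integral_grad Omega A (chi lambda F) phi +
  integral_Radon Omega (Defs.div Omega A) (fun x => chi lambda F x * phi x).
have JE : J (E_ n) @[n --> \oo] --> J E.
  apply: cvgD.
    (* The gradient term is a finite sum over coordinates, treated one by one with [psi] the [i]-th
       partial derivative of [phi]. *)
    apply: cvg_big => [|i _]; first exact: add_continuous.
    apply: (cvg_integral_Radon (D := D) (nrm := enorm) (mu := A)) => //.
    + by move=> v; exact: sqrtr_ge0.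
    + by move=> C; exact: coord_le_enorm.
    + by move=> x Dx; apply: partial_out_support; exact: contra_not (SD x) Dx.
  apply: (cvg_integral_Radon (D := D) (nrm := Num.norm) (mu := Defs.div Omega A)) => //.
  - by rewrite (Mloc_set0 DivO) normr0.
  - by move=> x; exact: differentiable_continuous (dphi x).
  - move=> x Dx; apply: contrapT => /eqP phix.
    exact/Dx/SD/subset_closure.
(* A convergent sequence has its limit as lower limit, which reduces the claim to a comparison for
   each [n]. *)
have -> : (J E)%:E = limn_einf (fun n => (J (E_ n))%:E).
  have JEe : (J (E_ n))%:E @[n --> \oo] --> (J E)%:E.
    by apply: cvg_EFin; first exact: nearW.
  by apply/esym; have [] := cvg_limn_einf_sup JEe.
(* The same [phi] is admissible in the supremum for every [E_ n]. *)
apply: le_limn_einf => n; apply: ereal_sup_ubound.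
by exists phi.
Qed.
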